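(* Let $F:\mathcal W\to\mathbb R^d$ satisfy $\|F(w)-F(v)\|_*\le L\|w-v\|$ for all $w,v\in\mathcal W$ ($L>0$), and let the norm $\|\cdot\|$ satisfy the norm assumption with constants $0<\gamma\le1$, $\delta>0$ (see context). Let $w_0\in\mathcal W$, $\sigma>0$, and let $w^*\in\mathcal W$ be a $\sigma$-weak solution, i.e. $\langle F(w),w-w^*\rangle\ge\frac{\sigma}{\gamma}\big(V_{w-w_0}(w^*-w_0)+V_{w^*-w_0}(w-w_0)\big)$ for all $w\in\mathcal W$. Let $D>0$ and run the OptDE iteration (see context) from $w_0$ with these $L,\gamma,\sigma$ and a parameter $0<\alpha\le\min\{\frac1{4\sqrt2},\frac{\sqrt3}{4\sqrt\gamma}\}$. Then for every $K\ge1$ the last iterate $w_K$ satisfies $$\sup_{w\in\mathcal W,\ \|w_K-w\|\le D}\langle F(w_K),w_K-w\rangle\le C_0D\|w_0-w^*\|\sqrt{\frac{L}{a_{K-1}}}$$ and $$\|w_K-w^*\|\le\frac{C_0}{\sigma}\|w_0-w^*\|\sqrt{\frac{L}{a_{K-1}}},$$ where $C_0=\big(1+\frac{\delta}{\alpha\gamma}\big)\sqrt{\frac{8\alpha}{\gamma}}$, $a_K=\frac{\alpha\gamma}{L}\big(1+\frac{\alpha\gamma\sigma}{L}\big)^{K-1}$ for all $K\ge1$, and $a_0=a_1$.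
   Context: $\mathcal W\subset\mathbb R^d$ is a (nonempty) closed convex set, $\|\cdot\|$ is a norm on $\mathbb R^d$ (possibly non-Euclidean), $\|y\|_*=\max_{\|x\|\le1}\langle x,y\rangle$ is its dual norm, and $\phi(x)=\frac12\|x\|^2$, with gradient $\nabla\phi$. Norm assumption with constants $0<\gamma\le1$, $\delta>0$: for all $w,v$, $\phi(w)\ge\phi(v)+\langle\nabla\phi(v),w-v\rangle+\frac\gamma2\|w-v\|^2$ and $\|\nabla\phi(w)\|_*\le\delta\|w\|$. Bregman divergence: $V_v(w)=\phi(w)-\phi(v)-\langle\nabla\phi(v),w-v\rangle$. Prox-mapping: $P_v(w)=\arg\min_{z\in\mathcal W}\{\langle w,z\rangle+\frac1{2\gamma}\|z-v\|^2\}$. OptDE iteration (Optimistic Dual Extrapolation): set $A_0=0$, $z_0=w_0$, $g_0=0$. For $k=1,2,\dots$: - $a_k=\frac{\alpha\gamma(1+\sigma A_{k-1})}{L}$, $A_k=A_{k-1}+a_k$ (so $a_k=\frac{\alpha\gamma}{L}(1+\frac{\alpha\gamma\sigma}{L})^{k-1}$); - $w_k=P_{z_{k-1}}\big(\frac{\alpha}{L}F(w_{k-1})\big)$; - $g_k=g_{k-1}+a_k\big(F(w_k)-\frac\sigma\gamma\nabla\phi(w_k-w_0)\big)$; - $z_k=P_{w_0}\big(\frac1{1+\sigma A_k}g_k\big)$. *)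

(* Defs.v *)
(* MathComp / MathComp-Analysis: R^d is 'rV[R]_d over an arbitrary realType R. *)
From mathcomp Require Import all_boot all_order all_algebra.
From mathcomp Require Import all_classical all_reals all_analysis.

Set Implicit Arguments.
Unset Strict Implicit.
Unset Printing Implicit Defensive.

Import Order.TTheory GRing.Theory Num.Theory.
Import numFieldNormedType.Exports.

Local Open Scope classical_set_scope.
Local Open Scope ring_scope.

Section Geometry.
Context {R : realType} {d : nat}.
Implicit Types (N : 'rV[R]_d -> R) (W : set 'rV[R]_d) (u v w x y z : 'rV[R]_d).

Definition dot x y : R := \sum_(i < d) x 0 i * y 0 i.

(* The norm of R^d is a parameter N: the canonical norm `|x| on 'rV[R]_d is the
   max norm, and is only used (through its topology) for closedness of W and
   differentiability of phi; this is harmless as all norms are equivalent. *)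
Record is_norm N : Prop := IsNorm {
  is_norm_triangle : forall x y, N (x + y) <= N x + N y;
  is_norm_scale : forall (c : R) x, N (c *: x) = `|c| * N x;
  is_norm_eq0 : forall x, N x = 0 -> x = 0 }.

(* The real-valued sup is 0 on unbounded sets, but the unit ball of N is
   nonempty and compact, so that this is the usual maximum. *)
Definition dual_norm N y : R := sup [set dot x y | x in [set x | N x <= 1]].

Definition half_sq N x : R := 2^-1 * N x ^+ 2.

Definition grad (f : 'rV[R]_d -> R) v : 'rV[R]_d :=
  \row_(i < d) 'd f v (delta_mx 0 i).

(* The first clause makes explicit that the gradient of phi exists. *)
Record norm_assumption N (gamma delta : R) : Prop := NormAssumption {
  phi_differentiable : forall v, differentiable (half_sq N) v;
  phi_strongly_convex : forall w v,
    half_sq N v + dot (grad (half_sq N) v) (w - v) + gamma / 2 * N (w - v) ^+ 2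
      <= half_sq N w;
  phi_grad_bound : forall w,
    dual_norm N (grad (half_sq N) w) <= delta * N w }.

Definition bregman N v w : R :=
  half_sq N w - half_sq N v - dot (grad (half_sq N) v) (w - v).

Definition weak_solution N W (F : 'rV[R]_d -> 'rV[R]_d) (gamma sigma : R)
    (w0 wstar : 'rV[R]_d) : Prop :=
  W wstar /\
  forall w, W w ->
    sigma / gamma * (bregman N (w - w0) (wstar - w0)
                     + bregman N (wstar - w0) (w - w0))
      <= dot (F w) (w - wstar).

Definition argmin W (f : 'rV[R]_d -> R) : set 'rV[R]_d :=
  [set z | W z /\ forall y, W y -> f z <= f y].

(* For W nonempty closed convex and N satisfying norm_assumption, the argmin is
   a singleton, so the default value 0 of xget is never used. *)
Definition prox N W (gamma : R) v w : 'rV[R]_d :=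
  xget 0 (argmin W (fun z => dot w z + (2 * gamma)^-1 * N (z - v) ^+ 2)).

End Geometry.

Section OptDE.
Context {R : realType} {d : nat}.

Record optde_state := OptDEState {
  optde_w : 'rV[R]_d;
  optde_z : 'rV[R]_d;
  optde_g : 'rV[R]_d;
  optde_A : R }.

Variables (N : 'rV[R]_d -> R) (W : set 'rV[R]_d) (F : 'rV[R]_d -> 'rV[R]_d).
Variables (L gamma sigma alpha : R) (w0 : 'rV[R]_d).

Definition optde_step (s : optde_state) : optde_state :=
  let a := alpha * gamma * (1 + sigma * optde_A s) / L in
  let A := optde_A s + a in
  let w := prox N W gamma (optde_z s) ((alpha / L) *: F (optde_w s)) in
  let g := optde_g s
    + a *: (F w - (sigma / gamma) *: grad (half_sq N) (w - w0)) in
  let z := prox N W gamma w0 ((1 + sigma * A)^-1 *: g) in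
  OptDEState w z g A.

Definition optde (k : nat) : optde_state :=
  iter k optde_step (OptDEState w0 w0 0 0).

End OptDE.

(* Main.v *)
Require Import Defs.
From mathcomp Require Import all_boot all_order all_algebra ring lra.
From mathcomp Require Import all_classical all_reals all_analysis.

Set Implicit Arguments.
Unset Strict Implicit.
Unset Printing Implicit Defensive.

Import Order.TTheory GRing.Theory Num.Theory.
Import numFieldNormedType.Exports.

Local Open Scope classical_set_scope.
Local Open Scope ring_scope.

(** The proof is an estimate-sequence argument. Write phi = N^2/2, b_k for the
    weight a_(k+1) of step k+1 and S_k = 1 + sigma A_k. The functions

      Psi_k(x) = phi(x - w0)/gamma + sum_(1 <= i <= k) b_(i-1) *
        (<F(w_i), x - w_i> + sigma/gamma V_(w_i - w0)(x - w0))

    differ from <g_k, x> + S_k/gamma phi(x - w0) by a constant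
    ([estimate_sub]), so z_k minimizes Psi_k on W and, phi being strongly
    convex, Psi_k grows at least like S_k/2 N(x - z_k)^2 away from z_k
    ([estimate_growth]).

    Two bounds on the minimum of Psi_k are then compared. At the weak solution,
    each term of the sum is nonpositive, since the defining inequality of wstar
    bounds <F(w_i), w_i - wstar> from below by the same Bregman term; hence
    Psi_k(z_k) <= phi(wstar - w0)/gamma ([estimate_wstar]). In the other
    direction the minimum increases at each step ([estimate_step]): with
    P_k = N(w_k - z_k), Q_k = N(w_(k+1) - z_k) and c = L/(4 alpha), the gain is
    at least

      b_k (c/gamma Q_k^2 + (c + sigma/2) P_(k+1)^2 - c/4 P_k^2).

    It comes from the growth of Psi_k, from the growth of the prox problem
    defining w_(k+1), and from the Lipschitz bound on F(w_(k+1)) - F(w_k),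
    which is where alpha <= 1/(4 sqrt 2) is used. The negative term is absorbed
    by the positive P_k^2 term of the previous step even though the weights
    grow geometrically, because their ratio 1 + gamma sigma/(4c) is compensated
    by sigma/2 ([estimate_absorb]). Telescoping bounds P_k and Q_k by
    N(w0 - wstar) ([optde_residual]).

    Finally the optimality condition of the prox problem defining w_(k+1)
    bounds <F(w_(k+1)), w_(k+1) - y> by a multiple of
    L (P_k + Q_k) N(w_(k+1) - y) ([optde_gap]). This is the first claim; for
    y = wstar the left-hand side is also at least
    sigma N(w_(k+1) - wstar)^2, which gives the second one. *)

(** * The dot product and the norm *)

Lemma subr_shift {V : zmodType} (u v x : V) : u - x - (v - x) = u - v.
Proof. by rewrite opprB addrA subrK. Qed.

Lemma lipschitz_continuous {R : realType} {V : normedModType R} (f : V -> R)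
    (C : R) :
  0 <= C -> (forall x y, f y - f x <= C * `|y - x|) -> continuous f.
Proof.
move=> C0 fC x; apply/cvgrPdist_le => /= e e0; near=> y.
have xy : C * `|x - y| <= e.
  rewrite (@le_trans _ _ ((C + 1) * `|x - y|)) ?ler_wpM2r ?lerDl//.
  rewrite -ler_pdivlMl ?ltr_wpDl//.
  near: y; apply: cvgr_dist_le; first exact: cvg_id.
  by rewrite mulr_gt0// invr_gt0 ltr_wpDl.
have := fC x y; have := fC y x; rewrite (distrC y).
by rewrite ler_norml; lra.
Unshelve. all: by end_near. Qed.

Section Dot.
Context {R : realType} {d : nat}.
Implicit Types (x y z : 'rV[R]_d) (c : R).

Lemma dotC x y : dot x y = dot y x.
Proof. by apply: eq_bigr => i _; rewrite mulrC. Qed.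

Lemma dotDr x y z : dot x (y + z) = dot x y + dot x z.
Proof. by rewrite -big_split; apply: eq_bigr => i _; rewrite mxE mulrDr. Qed.

Lemma dotZr c x y : dot x (c *: y) = c * dot x y.
Proof. by rewrite mulr_sumr; apply: eq_bigr => i _; rewrite mxE mulrCA. Qed.

Lemma dotNr x y : dot x (- y) = - dot x y.
Proof. by rewrite -scaleN1r dotZr mulN1r. Qed.

Lemma dotBr x y z : dot x (y - z) = dot x y - dot x z.
Proof. by rewrite dotDr dotNr. Qed.

Lemma dotDl x y z : dot (x + y) z = dot x z + dot y z.
Proof. by rewrite dotC dotDr !(dotC z). Qed.

Lemma dotZl c x y : dot (c *: x) y = c * dot x y.
Proof. by rewrite dotC dotZr (dotC y). Qed.

Lemma dotBl x y z : dot (x - y) z = dot x z - dot y z.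
Proof. by rewrite dotC dotBr !(dotC z). Qed.

Lemma dot0l x : dot 0 x = 0.
Proof. by rewrite -(scale0r x) dotZl mul0r. Qed.

Lemma coord_le_norm x i : `|x 0 i| <= `|x|.
Proof.
rewrite [leRHS]mx_normrE.
exact: (@le_bigmax _ _ _ 0 (fun ij : 'I_1 * 'I_d => `|x ij.1 ij.2|) (0, i)).
Qed.

Lemma dot_le_norm x y : dot x y <= (\sum_(i < d) `|x 0 i|) * `|y|.
Proof.
rewrite mulr_suml; apply: ler_sum => i _.
by rewrite (le_trans (ler_norm _))// normrM ler_wpM2l// coord_le_norm.
Qed.

Lemma continuous_dot x : continuous (dot x).
Proof.
apply: lipschitz_continuous => [|y z]; last first.
  by rewrite -dotBr; exact: dot_le_norm.
by apply: sumr_ge0 => i _.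
Qed.

Lemma dot_grad (f : 'rV[R]_d -> R) v x : dot (grad f v) x = 'd f v x.
Proof.
rewrite {2}(row_sum_delta x) linear_sum; apply: eq_bigr => i _.
by rewrite linearZ/= /grad mxE mulrC.
Qed.

End Dot.

Section Norms.
Context {R : realType} {d : nat} (N : 'rV[R]_d -> R) (N_norm : is_norm N).
Implicit Types (x y z : 'rV[R]_d) (c : R).

Lemma is_norm0 : N 0 = 0.
Proof. by rewrite -(scale0r 0) is_norm_scale// normr0 mul0r. Qed.

Lemma is_normN x : N (- x) = N x.
Proof. by rewrite -scaleN1r is_norm_scale// normrN1 mul1r. Qed.

Lemma is_normB x y : N (x - y) = N (y - x).
Proof. by rewrite -is_normN opprB. Qed.

Lemma is_norm_ge0 x : 0 <= N x.
Proof.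
have := is_norm_triangle N_norm x (- x).
by rewrite subrr is_norm0 is_normN; lra.
Qed.

Lemma is_norm_sub x y z : N (x - z) <= N (x - y) + N (y - z).
Proof. by rewrite (le_trans _ (is_norm_triangle N_norm _ _))// subrKA. Qed.

Lemma is_norm_le_norm x : N x <= (\sum_(i < d) N (delta_mx 0 i)) * `|x|.
Proof.
rewrite {1}(row_sum_delta x) mulr_suml.
apply: (big_ind2 (fun u r => N u <= r)) => [|u r v s ur vs|i _].
- by rewrite is_norm0.
- by rewrite (le_trans (is_norm_triangle N_norm _ _))// lerD.
- rewrite is_norm_scale// mulrC ler_wpM2l ?is_norm_ge0//.
  exact: coord_le_norm.
Qed.

Lemma continuous_is_norm : continuous N.
Proof.
apply: lipschitz_continuous => [|x y]; last first.
  apply: le_trans (is_norm_le_norm _).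
  by have := is_norm_sub y x 0; rewrite !subr0; lra.
by apply: sumr_ge0 => i _; exact: is_norm_ge0.
Qed.

(** The minimum of N over the compact unit sphere of the ambient norm is
    positive because N separates points. *)
Lemma norm_le_is_norm : exists2 m, 0 < m & forall x, m * `|x| <= N x.
Proof.
pose S := [set x : 'rV[R]_d | `|x| = 1].
have [S0|/set0P S0] := eqVneq S set0.
  (* For d = 0 the sphere is empty and every vector is 0. *)
  exists 1 => // x; have [->|x0] := eqVneq x 0.
    by rewrite normr0 mulr0 is_norm0.
  have : S (`|x|^-1 *: x).
    by rewrite /S/= normrZ normfV normr_id mulVf// normr_eq0.
  by rewrite S0.
have cS : compact S.
  apply: bounded_closed_compact.
    by exists 1; split => // M M1 x /= ->; exact: ltW.
  apply: (@preimage_closed _ _ (fun x : 'rV[R]_d => `|x|) [set 1]).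
    by move=> x _; exact: norm_continuous.
  exact: closed_eq.
have [|x Sx Nx] := EVT_min_rV (f := N) S0 cS.
  exact/continuous_subspaceT/continuous_is_norm.
have x1 : `|x| = 1 by rewrite inE in Sx.
exists (N x).
  rewrite lt_def is_norm_ge0 andbT; apply/eqP => /(is_norm_eq0 N_norm) x0.
  by move: x1; rewrite x0 normr0 => /eqP; rewrite eq_sym oner_eq0.
move=> y; have [->|y0] := eqVneq y 0; first by rewrite normr0 mulr0 is_norm0.
have ny : 0 < `|y| by rewrite normr_gt0.
rewrite -ler_pdivlMr// mulrC.
have := Nx (`|y|^-1 *: y); rewrite is_norm_scale// normfV normr_id; apply.
by rewrite inE /S/= normrZ normfV normr_id mulVf// gt_eqF.
Qed.

(** The dual norm is a real-valued supremum, so the inequality needs the set of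
    values of the pairing on the unit ball to be bounded; this is where the
    comparison with the ambient norm enters. *)
Lemma dot_le_dual_norm x y : dot x y <= N x * dual_norm N y.
Proof.
have [x0|x0] := eqVneq (N x) 0.
  by rewrite x0 mul0r (is_norm_eq0 N_norm x0) dot0l.
have Nx : 0 < N x by rewrite lt_def x0 is_norm_ge0.
rewrite -ler_pdivrMl//; apply: ub_le_sup; last first.
  exists ((N x)^-1 *: x); last by rewrite dotZl.
  by rewrite /= is_norm_scale// normfV (gtr0_norm Nx) mulVf.
have [m m0 mN] := norm_le_is_norm.
exists ((\sum_(i < d) `|y 0 i|) * m^-1) => _ [z /= z1 <-].
rewrite dotC (le_trans (dot_le_norm _ _))// ler_wpM2l ?sumr_ge0//.
by rewrite -[leRHS]mulr1 ler_pdivlMl// (le_trans (mN z)).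
Qed.

End Norms.

(** * The prox-mapping *)

(** The differential is the limit of the difference quotients from the right,
    so a lower bound on the increments along a short ray suffices. This turns
    minimality over a convex set, where only inward directions are available,
    into a first-order condition. *)
Lemma le_diff {R : realType} {V : normedModType R} (f : V -> R) (a h : V)
    (c : R) :
  differentiable f a ->
  (forall t : R, 0 < t -> t <= 1 -> t * c <= f (a + t *: h) - f a) ->
  c <= 'd f a h.
Proof.
move=> df fc; rewrite -deriveE//.
have /cvg_dnbhs_at_right dfh : derivable f a h by exact: diff_derivable.
rewrite /derive -(cvg_lim _ dfh)//; apply: limr_ge; first exact: cvgP dfh.
near=> t; have t0 : 0 < t by near: t; exact: nbhs_right_gt.
have t1 : t <= 1 by near: t; exact: nbhs_right_le.
rewrite [leRHS](_ : _ = t^-1 * (f (t *: h + a) - f a))//.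
by rewrite ler_pdivlMl// (addrC (t *: h)) fc.
Unshelve. all: by end_near. Qed.

Section Prox.
Context {R : realType} {d : nat} (N : 'rV[R]_d -> R) (W : set 'rV[R]_d).
Context (gamma delta : R) (N_norm : is_norm N) (W_closed : closed W)
  (W_convex : convex_set W) (W_neq0 : W !=set0) (gamma_gt0 : 0 < gamma)
  (N_assumption : norm_assumption N gamma delta).
Implicit Types v w x y z : 'rV[R]_d.

Let igamma : 0 < gamma^-1. Proof. by rewrite invr_gt0. Qed.

(** The quadratic term dominates the linear one, so the sublevel set of any
    point of W is bounded; it is closed by continuity, hence compact. *)
Lemma argmin_neq0 (c : R) v w : 0 < c ->
  argmin W (fun z => dot w z + c * N (z - v) ^+ 2) !=set0.
Proof.
move=> c0; set f := fun z => _; have [u Wu] := W_neq0.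
have cN : continuous (fun z => N (z - v)).
  move=> z; apply: (@continuous_comp _ _ _ (fun y => y - v) N).
    apply: (@cvgB _ _ _ _ (nbhs_filter z)); first exact: cvg_id.
    exact: cvg_cst.
  exact: continuous_is_norm.
have cf : continuous f.
  move=> z; apply: (@cvgD _ _ _ _ (nbhs_filter z)).
    exact: continuous_dot.
  apply: (@cvgM _ _ _ (nbhs_filter z)); first exact: cvg_cst.
  by apply: (@cvgM _ _ _ (nbhs_filter z)); exact: cN.
pose A := W `&` [set z | f z <= f u].
have A0 : A !=set0 by exists u; split => //=.
have cA : compact A.
  apply: bounded_closed_compact; last first.
    apply: closedI => //.
    apply: (@preimage_closed _ _ f [set x | x <= f u]); last exact: closed_le.
    by move=> z _; exact: cf.
  have [m m0 mN] := norm_le_is_norm N_norm.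
  pose B := \sum_(i < d) `|w 0 i|.
  have B0 : 0 <= B by apply: sumr_ge0.
  pose K := `|f u| + B * `|v|.
  have K0 : 0 <= K by rewrite addr_ge0// mulr_ge0.
  have cm0 : 0 < c * m ^+ 2 by rewrite mulr_gt0// exprn_gt0.
  (* With t = |z - v|, f z <= f u gives c m^2 t^2 <= K + B t, and this is at
     most (K + B) t as soon as t > 1. *)
  exists (1 + (K + B) / (c * m ^+ 2) + `|v|); split; first exact: num_real.
  move=> M M1 z [_ /= fz].
  apply: le_trans (ltW M1).
  have zv : `|z| <= `|z - v| + `|v| by rewrite -{1}(subrK v z) ler_normD.
  apply: le_trans zv _; rewrite lerD2r.
  have [t1|t1] := leP `|z - v| 1.
    by rewrite (le_trans t1)// lerDl divr_ge0 ?(ltW cm0)// addr_ge0.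
  rewrite (@le_trans _ _ ((K + B) / (c * m ^+ 2))) ?lerDr// ler_pdivlMr//.
  have t0 : 0 < `|z - v| by exact: lt_trans t1.
  rewrite -(ler_pM2r t0).
  have quad : c * (m * `|z - v|) ^+ 2 <= c * N (z - v) ^+ 2.
    by rewrite ler_pM2l// lerXn2r ?nnegrE ?mulr_ge0 ?(ltW m0)// is_norm_ge0.
  have lin : - dot w z <= B * `|z|.
    by rewrite -dotNr -normrN; exact: dot_le_norm.
  have tri : B * `|z| <= B * (`|z - v| + `|v|).
    by rewrite ler_wpM2l// -{1}(subrK v z) ler_normD.
  have fu_le : f u <= `|f u| by exact: ler_norm.
  have K_le : K <= K * `|z - v| by rewrite ler_peMr// ltW.
  move: fz quad lin tri fu_le K_le; rewrite /f /K.
  by set X := N (z - v); set t := `|z - v|; nra.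
have [|x] := EVT_min_rV A0 cA (f := f).
  exact: continuous_subspaceT.
rewrite inE => -[Wx fxu] xmin; exists x; split => // y Wy.
have [fyu|/ltW fuy] := leP (f y) (f u); last exact: le_trans fuy.
by apply: xmin; rewrite inE.
Qed.

Lemma prox_argmin v w : argmin W
  (fun z => dot w z + (2 * gamma)^-1 * N (z - v) ^+ 2) (prox N W gamma v w).
Proof.
rewrite /prox; case: xgetP => [//|noargmin].
have [|x xmin] := @argmin_neq0 (2 * gamma)^-1 v w.
  by rewrite invr_gt0 mulr_gt0.
by case: (noargmin x).
Qed.

Lemma prox_in v w : W (prox N W gamma v w).
Proof. by have [] := prox_argmin v w. Qed.

(** Otherwise the objective would decrease along the segment from the minimizer
    to y, which stays in W by convexity. *)
Lemma prox_variational v w y : W y ->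
  0 <= dot (w + gamma^-1 *: grad (half_sq N) (prox N W gamma v w - v))
           (y - prox N W gamma v w).
Proof.
set p := prox N W gamma v w => Wy.
have [Wp pmin] := prox_argmin v w; rewrite -/p in Wp pmin.
have N_diff := phi_differentiable N_assumption.
have scaled :
    - gamma * dot w (y - p) <= dot (grad (half_sq N) (p - v)) (y - p).
  rewrite dot_grad; apply: le_diff => // t t0 t1.
  have Wt : W (p + t *: (y - p)).
    have := W_convex (Itv01 (ltW t0) t1) (mem_set Wy) (mem_set Wp).
    rewrite inE; congr W; rewrite /conv/=.
    by rewrite scalerBr scalerBl scale1r addrCA.
  have := pmin _ Wt.
  rewrite dotDr dotZr (addrAC p) /half_sq invfM.
  set X := N _ ^+ 2; set Y := N _ ^+ 2; set c := dot _ _ => XY.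
  have gammaV : gamma * (2^-1 * gamma^-1) = 2^-1.
    by rewrite mulrCA mulfV ?mulr1 ?gt_eqF.
  have := ler_wpM2l (ltW gamma_gt0) XY.
  by rewrite !mulrDr !(mulrA gamma (_ * _)) gammaV; lra.
rewrite dotDl dotZl.
have := ler_wpM2l (ltW igamma) scaled.
by rewrite mulNr mulrN mulKf ?gt_eqF//; lra.
Qed.

(** Strong convexity of phi turns the first-order condition into quadratic
    growth around the minimizer; the modulus is 1/2 because the prox-mapping
    rescales phi by 1/gamma. *)
Lemma prox_growth v w y (p := prox N W gamma v w) : W y ->
  dot w p + gamma^-1 * half_sq N (p - v) + 2^-1 * N (y - p) ^+ 2
    <= dot w y + gamma^-1 * half_sq N (y - v).
Proof.
move=> Wy; have := prox_variational v w Wy; rewrite -/p.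
have := phi_strongly_convex N_assumption (y - v) (p - v).
rewrite subr_shift => /(ler_wpM2l (ltW igamma)).
rewrite dotDl dotZl (dotBr w) !mulrDr.
by rewrite (mulrA gamma^-1 (gamma / 2)) mulKf ?gt_eqF//; lra.
Qed.

(** Both arguments are translated by the same vector because the iteration only
    meets divergences centred at the starting point. *)
Lemma bregman_ge v x y :
  gamma / 2 * N (y - x) ^+ 2 <= bregman N (x - v) (y - v).
Proof.
have := phi_strongly_convex N_assumption (y - v) (x - v).
by rewrite /bregman subr_shift; lra.
Qed.

End Prox.

(** * Optimistic dual extrapolation *)

Section OptDE.
Context {R : realType} {d : nat} (N : 'rV[R]_d -> R) (W : set 'rV[R]_d)
  (F : 'rV[R]_d -> 'rV[R]_d) (L gamma delta sigma alpha : R)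
  (w0 wstar : 'rV[R]_d).
Context (N_norm : is_norm N) (W_closed : closed W) (W_convex : convex_set W)
  (L_gt0 : 0 < L)
  (F_lipschitz : forall w v, W w -> W v ->
     dual_norm N (F w - F v) <= L * N (w - v))
  (gamma_gt0 : 0 < gamma) (gamma_le1 : gamma <= 1) (delta_gt0 : 0 < delta)
  (N_assumption : norm_assumption N gamma delta) (w0_in : W w0)
  (sigma_gt0 : 0 < sigma)
  (wstar_sol : weak_solution N W F gamma sigma w0 wstar)
  (alpha_gt0 : 0 < alpha) (alpha_le : 32 * alpha ^+ 2 <= 1).
Implicit Types (x y : 'rV[R]_d) (k : nat).

Local Notation s k := (optde N W F L gamma sigma alpha w0 k).
Local Notation w k := (optde_w (s k)).
Local Notation z k := (optde_z (s k)).
Local Notation g k := (optde_g (s k)).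
Local Notation phi := (half_sq N).
Local Notation S k := (1 + sigma * optde_A (s k)).
Local Notation b k := (alpha * gamma * S k / L).
Local Notation rho := (1 + alpha * gamma * sigma / L).
Local Notation c := (L / (4 * alpha)).

Let W_neq0 : W !=set0. Proof. by exists w0. Qed.

Lemma optde_weightS k : S k.+1 = S k + sigma * b k.
Proof. by rewrite /= mulrDr addrA. Qed.

Lemma optde_gS k :
  g k.+1 = g k
    + b k *: (F (w k.+1) - (sigma / gamma) *: grad phi (w k.+1 - w0)).
Proof. by []. Qed.

Lemma optde_weight k : S k = rho ^+ k.
Proof.
elim: k => [|k IH]; first by rewrite /= mulr0 addr0.
by rewrite exprSr -IH optde_weightS; ring.
Qed.

Lemma optde_in k : W (w k) /\ W (z k).
Proof.
by case: k => [//|k]; split; exact: (prox_in N_norm W_closed W_neq0).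
Qed.

Let ratio_gt0 : 0 < alpha * gamma * sigma / L.
Proof. by rewrite divr_gt0 ?mulr_gt0. Qed.

Let S_gt0 k : 0 < S k.
Proof. by rewrite optde_weight exprn_gt0// addr_gt0. Qed.

Let b_gt0 k : 0 < b k.
Proof. by rewrite divr_gt0 ?mulr_gt0. Qed.

Let ig_gt0 : 0 < gamma^-1. Proof. by rewrite invr_gt0. Qed.

Let sg_gt0 : 0 < sigma / gamma. Proof. by rewrite divr_gt0. Qed.

Let c_gt0 : 0 < c.
Proof. by rewrite divr_gt0 ?mulr_gt0. Qed.

(** The estimate function Psi_k. Unlike the linear functional g_k it keeps the
    constants, which is what makes its value at wstar and its increments
    meaningful. *)
Fixpoint estimate k x : R :=
  if k is j.+1 then
    estimate j x + b j * (dot (F (w j.+1)) (x - w j.+1)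
      + sigma / gamma * bregman N (w j.+1 - w0) (x - w0))
  else gamma^-1 * phi (x - w0).

Lemma estimateS k x :
  estimate k.+1 x = estimate k x + b k * (dot (F (w k.+1)) (x - w k.+1)
      + sigma / gamma * bregman N (w k.+1 - w0) (x - w0)).
Proof. by []. Qed.

(** The Bregman terms contribute a linear functional and a multiple of
    phi(x - w0), whose weights accumulate into g_k and S_k. *)
Lemma estimate_sub k x y :
  estimate k x - estimate k y
  = dot (g k) (x - y) + S k / gamma * (phi (x - w0) - phi (y - w0)).
Proof.
elim: k => [|k IH]; first by rewrite /= dot0l; ring.
rewrite !estimateS opprD addrACA IH optde_gS optde_weightS /bregman.
rewrite !subr_shift !dotBr !dotDl !dotZl !dotBl !dotZl.
by ring.
Qed.

Lemma estimate_growth k x : W x ->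
  estimate k (z k) + S k / 2 * N (x - z k) ^+ 2 <= estimate k x.
Proof.
move=> Wx; case: k => [|k].
  (* Nothing has been minimized yet: z_0 = w0 is the zero of Psi_0, and the
     growth is exact up to the factor 1/gamma >= 1. *)
  rewrite /= subrr mulr0 addr0 /half_sq is_norm0// expr0n/= mulr0 mulr0 add0r.
  rewrite mul1r ler_peMl ?mulr_ge0 ?is_norm_ge0//.
  by rewrite invf_ge1.
rewrite -subr_ge0 opprD addrA estimate_sub subr_ge0.
have := prox_growth N_norm W_closed W_convex W_neq0 gamma_gt0 N_assumption
  w0 ((S k.+1)^-1 *: g k.+1) Wx.
rewrite -[prox _ _ _ _ _]/(z k.+1) !dotZl dotBr.
move: (S_gt0 k.+1); set S' := 1 + _ => S'_gt0 /(ler_wpM2l (ltW S'_gt0)).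
by rewrite !mulrDr !mulVKf ?gt_eqF//; lra.
Qed.

(** Every increment of Psi_k at wstar is nonpositive: by the weak-solution
    inequality it is at most -sigma/gamma V_(wstar - w0)(w_i - w0). *)
Lemma estimate_wstar k : estimate k wstar <= gamma^-1 * phi (wstar - w0).
Proof.
elim: k => [//|k]; apply: le_trans; rewrite estimateS gerDl.
have [_ /(_ _ (optde_in k.+1).1)] := wstar_sol.
have : 0 <= bregman N (wstar - w0) (w k.+1 - w0).
  apply: le_trans (bregman_ge N_assumption _ _ _).
  by rewrite mulr_ge0 ?sqr_ge0// ltW// divr_gt0.
move=> /(mulr_ge0 (ltW sg_gt0)) B0; rewrite mulrDr => sol.
rewrite (pmulr_rle0 _ (b_gt0 k)) -(opprB (w k.+1)) dotNr.
by move: B0 sol; lra.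
Qed.

Lemma dot_dF_le k x :
  dot (F (w k.+1) - F (w k)) x
  <= L * (N (w k - z k) + N (w k.+1 - z k)) * N x.
Proof.
rewrite dotC (le_trans (dot_le_dual_norm N_norm _ _))// mulrC.
rewrite ler_wpM2r ?is_norm_ge0//.
apply: le_trans (F_lipschitz (optde_in k.+1).1 (optde_in k).1) _.
rewrite ler_pM2l// [leRHS]addrC (is_normB N_norm (w k) (z k)).
exact: (is_norm_sub N_norm).
Qed.

(** The gain of one step. The growth of Psi_k at z_(k+1) provides a multiple of
    N(z_(k+1) - z_k)^2, which the prox problem defining w_(k+1), compared at
    z_(k+1), converts into Q_k^2 and P_(k+1)^2 at the price of evaluating F at
    w_k instead of w_(k+1); the Lipschitz bound controls this mismatch. *)
Lemma estimate_step k :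
  estimate k (z k)
  + b k * (c / gamma * N (w k.+1 - z k) ^+ 2
           + (c + sigma / 2) * N (w k.+1 - z k.+1) ^+ 2
           - c / 4 * N (w k - z k) ^+ 2)
  <= estimate k.+1 (z k.+1).
Proof.
have [[_ _] [_ Wz']] := (optde_in k, optde_in k.+1).
have growth := estimate_growth k Wz'.
have inner := prox_growth N_norm W_closed W_convex W_neq0 gamma_gt0
  N_assumption (z k) ((alpha / L) *: F (w k)) Wz'.
rewrite -[prox _ _ _ _ _]/(w k.+1) in inner.
have lip := dot_dF_le k (w k.+1 - z k.+1).
have breg : sigma / 2 * N (w k.+1 - z k.+1) ^+ 2
    <= sigma / gamma * bregman N (w k.+1 - w0) (z k.+1 - w0).
  have := bregman_ge N_assumption w0 (w k.+1) (z k.+1).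
  rewrite (is_normB N_norm (z _)) => /(ler_wpM2l (ltW sg_gt0)); apply: le_trans.
  by rewrite le_eqVlt; apply/orP; left; apply/eqP; field; rewrite gt_eqF.
have cross : L * (N (w k - z k) + N (w k.+1 - z k)) * N (w k.+1 - z k.+1)
    <= c * N (w k.+1 - z k.+1) ^+ 2
       + c / 4 * (N (w k - z k) ^+ 2 + N (w k.+1 - z k) ^+ 2).
  rewrite [X in X * _ * _ <= _](_ : _ = 4 * alpha * c); last first.
    by field; rewrite gt_eqF.
  move: (N (w k - z k)) (N (w k.+1 - z k)) (N (w k.+1 - z k.+1)) => P Q P'.
  rewrite -subr_ge0.
  (* Young's inequality and (P + Q)^2 <= 2 (P^2 + Q^2), as sums of squares. *)
  have -> : c * P' ^+ 2 + c / 4 * (P ^+ 2 + Q ^+ 2)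
        - 4 * alpha * c * (P + Q) * P'
      = c * ((P' - 2 * alpha * (P + Q)) ^+ 2
             + (1 - 32 * alpha ^+ 2) / 8 * (P + Q) ^+ 2 + (P - Q) ^+ 2 / 8).
    by field; rewrite gt_eqF.
  rewrite mulr_ge0 ?(ltW c_gt0)// !addr_ge0 ?sqr_ge0 ?divr_ge0 ?sqr_ge0//.
  by rewrite mulr_ge0 ?sqr_ge0// divr_ge0// subr_ge0.
have Q_gamma :
    c / 4 * N (w k.+1 - z k) ^+ 2 <= c / gamma * N (w k.+1 - z k) ^+ 2.
  rewrite ler_wpM2r ?sqr_ge0// ler_pM2l// lef_pV2 ?posrE//.
  by rewrite (le_trans gamma_le1)// ler1n.
rewrite estimateS.
have SE : S k = b k * (4 * c / gamma) by field; rewrite !gt_eqF.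
rewrite SE in growth.
apply: le_trans (lerD growth (lexx _)).
rewrite -[leRHS]addrA lerD2l -(mulrA (b k)) -(mulrA (b k)) -mulrDr.
rewrite ler_pM2l ?b_gt0//.
have {}inner : 4^-1 * dot (F (w k)) (w k.+1)
      + c / gamma * (N (w k.+1 - z k) ^+ 2 / 2)
      + c * (N (w k.+1 - z k.+1) ^+ 2 / 2)
    <= 4^-1 * dot (F (w k)) (z k.+1)
      + c / gamma * (N (z k.+1 - z k) ^+ 2 / 2).
  have := ler_wpM2l (ltW c_gt0) inner.
  rewrite !dotZl /half_sq (is_normB N_norm (z k.+1) (w k.+1)).
  by congr (_ <= _); field; rewrite !gt_eqF.
move: lip; rewrite dotBl (dotBr (F (w k.+1))) (dotBr (F (w k))) dotBr.
by lra.
Qed.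

(** From here on the weight preceding b_k is written b_(k.-1). For k = 0 this is
    b_0 itself, in accordance with the convention a_0 = a_1. *)
Lemma optde_coef_le k : b k.-1 <= b k.
Proof.
case: k => [//|k]; rewrite !ler_pM2r ?invr_gt0// ler_pM2l ?mulr_gt0//.
by rewrite optde_weightS lerDl ltW// mulr_gt0 ?b_gt0.
Qed.

Lemma optde_coef_ratio k : b k <= b k.-1 * rho.
Proof.
case: k => [|k]; first by rewrite ler_peMr ?(ltW (b_gt0 _))// lerDl ltW.
rewrite [k.+1.-1]/= (optde_weight k.+1) exprSr -optde_weight.
by rewrite le_eqVlt; apply/orP; left; apply/eqP; field; rewrite gt_eqF.
Qed.

(** The loss of step k+1 against what step k left over. The weights grow by the
    factor rho = 1 + gamma sigma/(4c), so the loss is at most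
    b_(k.-1) (c/4 + gamma sigma/16) P_k^2, and three quarters of c P_k^2
    survive. *)
Lemma estimate_absorb k :
  b k * (c / 4 * N (w k - z k) ^+ 2) + b k.-1 * (3 / 4 * c * N (w k - z k) ^+ 2)
  <= b k.-1 * ((c + sigma / 2) * N (w k - z k) ^+ 2).
Proof.
have := optde_coef_ratio k; have := b_gt0 k.-1.
move: (b k) (b k.-1) (N _) => b1 b0 P b0_gt0 b1_le.
suff : b1 * (c / 4) + b0 * (3 / 4 * c) <= b0 * (c + sigma / 2).
  by move=> /(ler_wpM2r (sqr_ge0 P)); lra.
have : b1 * c <= b0 * (c + gamma * sigma / 4).
  have := ler_wpM2r (ltW c_gt0) b1_le.
  by congr (_ <= _); field; rewrite !gt_eqF.
have : b0 * (gamma * sigma) <= b0 * sigma.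
  by rewrite ler_pM2l// ler_piMl// ltW.
have : 0 < b0 * sigma by rewrite mulr_gt0.
by lra.
Qed.

(** The induction retains only the last P_k^2, which is all that the next step
    consumes; for k = 0 both sides vanish since w_0 = z_0 = w0. *)
Lemma estimate_ge k :
  b k.-1 * ((c + sigma / 2) * N (w k - z k) ^+ 2) <= estimate k (z k).
Proof.
elim: k => [|k IH].
  by rewrite /= /half_sq !subrr is_norm0// expr0n/= !mulr0.
apply: le_trans (estimate_step k).
have := estimate_absorb k.
have : 0 <= b k.-1 * (3 / 4 * c * N (w k - z k) ^+ 2).
  by rewrite mulr_ge0 ?(ltW (b_gt0 _))// mulr_ge0 ?sqr_ge0// mulr_ge0// ltW.
have : 0 <= b k * (c / gamma * N (w k.+1 - z k) ^+ 2).
  by rewrite mulr_ge0 ?(ltW (b_gt0 _))// mulr_ge0 ?sqr_ge0// ltW// divr_gt0.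
by move: IH; rewrite [k.+1.-1]/=; move: (b k) (b k.-1) => b1 b0; lra.
Qed.

Lemma optde_residual_sq k :
  b k.-1 * c * (3 / 4 * N (w k - z k) ^+ 2 + N (w k.+1 - z k) ^+ 2)
  <= gamma^-1 * phi (wstar - w0).
Proof.
apply: le_trans (estimate_wstar k.+1).
have [Wstar _] := wstar_sol.
have := estimate_growth k.+1 Wstar.
have : 0 <= S k.+1 / 2 * N (wstar - z k.+1) ^+ 2.
  by rewrite mulr_ge0 ?sqr_ge0// divr_ge0// ltW.
have := estimate_step k; have := estimate_ge k; have := estimate_absorb k.
have : 0 <= b k * ((c + sigma / 2) * N (w k.+1 - z k.+1) ^+ 2).
  rewrite mulr_ge0 ?(ltW (b_gt0 _))// mulr_ge0 ?sqr_ge0//.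
  by rewrite addr_ge0 ?(ltW c_gt0)// divr_ge0// ltW.
have : b k.-1 * (c * N (w k.+1 - z k) ^+ 2)
    <= b k * (c / gamma * N (w k.+1 - z k) ^+ 2).
  rewrite ler_pM ?optde_coef_le ?(ltW (b_gt0 _))//.
    by rewrite mulr_ge0 ?sqr_ge0 ?(ltW c_gt0).
  by rewrite ler_wpM2r ?sqr_ge0// ler_peMr ?(ltW c_gt0)// invf_ge1.
move: (b k) (b k.-1) (S k.+1) (estimate k.+1) => b1 b0 S1 E1.
by lra.
Qed.

(** Since (P + Q)^2 <= 4 (3/4 P^2 + Q^2) and L = 4 alpha c, the previous bound
    produces exactly the constant 8 alpha/gamma. *)
Lemma optde_residual k :
  L * (N (w k - z k) + N (w k.+1 - z k))
  <= Num.sqrt (8 * alpha / gamma) * N (w0 - wstar) * Num.sqrt (L / b k.-1).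
Proof.
have N0 := is_norm_ge0 N_norm; have b0 := b_gt0 k.-1.
rewrite -ler_sqr ?nnegrE ?mulr_ge0 ?addr_ge0 ?sqrtr_ge0 ?(ltW L_gt0)//.
rewrite !exprMn !sqr_sqrtr; first last.
- by rewrite divr_ge0 ?mulr_ge0 ?ltW.
- by rewrite divr_ge0 ?(ltW L_gt0) ?(ltW b0).
have := optde_residual_sq k; rewrite /half_sq (is_normB N_norm wstar).
move: (b k.-1) b0 (N (w k - z k)) (N (w k.+1 - z k)) (N (w0 - wstar)).
move=> b0 b0_gt0 P Q D residual.
have k_gt0 : 0 < 16 * alpha * (L / b0) by rewrite !mulr_gt0 ?invr_gt0.
have bc_gt0 : 0 < b0 * c by rewrite mulr_gt0.
have PQ : b0 * c * ((P + Q) ^+ 2 / 4) <= gamma^-1 * (2^-1 * D ^+ 2).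
  apply: le_trans residual; rewrite ler_pM2l//.
  by have := sqr_ge0 (P - Q); have := sqr_ge0 P; have := sqr_ge0 Q; lra.
have := ler_wpM2l (ltW k_gt0) PQ.
by congr (_ <= _); field; rewrite !gt_eqF.
Qed.

(** The optimality condition of w_(k+1) controls F(w_k) by the gradient of phi
    at w_(k+1) - z_k, of dual norm at most delta Q_k; replacing F(w_k) by
    F(w_(k+1)) costs L (P_k + Q_k). *)
Lemma optde_gap k y : W y ->
  dot (F (w k.+1)) (w k.+1 - y)
  <= (1 + delta / (alpha * gamma))
     * (L * (N (w k - z k) + N (w k.+1 - z k))) * N (w k.+1 - y).
Proof.
move=> Wy; have N0 := is_norm_ge0 N_norm.
have lip := dot_dF_le k (w k.+1 - y).
have := prox_variational N_norm W_closed W_convex W_neq0 gamma_gt0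
  N_assumption (z k) ((alpha / L) *: F (w k)) Wy.
rewrite -[prox _ _ _ _ _]/(w k.+1) dotDl !dotZl -(opprB (w k.+1)) !dotNr.
set G := grad _ _ => vi.
have G_le : - dot G (w k.+1 - y) <= delta * N (w k.+1 - z k) * N (w k.+1 - y).
  rewrite -dotNr dotC (le_trans (dot_le_dual_norm N_norm _ _))//.
  rewrite (is_normN N_norm) mulrC ler_wpM2r//.
  exact: (phi_grad_bound N_assumption).
have {vi}vi : dot (F (w k)) (w k.+1 - y)
    <= L * (delta / (alpha * gamma)) * N (w k.+1 - z k) * N (w k.+1 - y).
  have La : 0 < L / alpha by rewrite divr_gt0.
  have : alpha / L * dot (F (w k)) (w k.+1 - y)
      <= gamma^-1 * (delta * N (w k.+1 - z k) * N (w k.+1 - y)).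
    by have := ler_wpM2l (ltW ig_gt0) G_le; lra.
  move=> /(ler_wpM2l (ltW La)).
  by congr (_ <= _); field; rewrite !gt_eqF.
have P_ge0 :
    0 <= L * (delta / (alpha * gamma)) * N (w k - z k) * N (w k.+1 - y).
  do 2![apply: mulr_ge0 => //].
  by rewrite ltW// mulr_gt0 ?divr_gt0 ?mulr_gt0.
move: lip; rewrite dotBl.
by lra.
Qed.

End OptDE.

Theorem proposition1 (R : realType) (d : nat)
  (N : 'rV[R]_d -> R) (W : set 'rV[R]_d) (F : 'rV[R]_d -> 'rV[R]_d)
  (L gamma delta sigma alpha D : R) (w0 wstar : 'rV[R]_d) (a : nat -> R)
  (N_norm : is_norm N)
  (W_closed : closed W)
  (W_convex : convex_set W)
  (L_gt0 : 0 < L)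
  (F_lipschitz : forall w v, W w -> W v ->
     dual_norm N (F w - F v) <= L * N (w - v))
  (gamma_gt0 : 0 < gamma) (gamma_le1 : gamma <= 1) (delta_gt0 : 0 < delta)
  (N_assumption : norm_assumption N gamma delta)
  (w0_in : W w0)
  (sigma_gt0 : 0 < sigma)
  (wstar_sol : weak_solution N W F gamma sigma w0 wstar)
  (D_gt0 : 0 < D)
  (alpha_gt0 : 0 < alpha)
  (alpha_le : alpha <= Num.min (1 / (4 * Num.sqrt 2))
                               (Num.sqrt 3 / (4 * Num.sqrt gamma)))
  (a_closed_form : forall K : nat, (1 <= K)%N ->
     a K = alpha * gamma / L * (1 + alpha * gamma * sigma / L) ^+ (K - 1)%N)
  (a_zero : a 0%N = a 1%N) :
  let C0 := (1 + delta / (alpha * gamma)) * Num.sqrt (8 * alpha / gamma) in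
  forall K : nat, (1 <= K)%N ->
  let wK := optde_w (optde N W F L gamma sigma alpha w0 K) in
  (ereal_sup [set (dot (F wK) (wK - w)%R)%:E |
                w in [set w | W w /\ N (wK - w)%R <= D]%R]
     <= (C0 * D * N (w0 - wstar)%R * Num.sqrt (L / a (K - 1)%N))%R%:E)%E
  /\
  N (wK - wstar) <= C0 / sigma * N (w0 - wstar) * Num.sqrt (L / a (K - 1)%N).
Proof.
move=> C0 [//|k] _ wK.
have alpha_sqr : 32 * alpha ^+ 2 <= 1.
  have alpha_min : alpha <= 1 / (4 * Num.sqrt 2).
    by apply: le_trans alpha_le _; rewrite ge_min lexx.
  have s2 : 0 < 4 * Num.sqrt 2 :> R by rewrite mulr_gt0// sqrtr_gt0.
  move: alpha_min; rewrite ler_pdivlMr// => alpha_min.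
  have : (alpha * (4 * Num.sqrt 2)) ^+ 2 <= 1.
    by rewrite expr_le1// mulr_ge0// ltW.
  by rewrite !exprMn sqr_sqrtr//; lra.
pose a_ j := alpha * gamma
  * (1 + sigma * optde_A (optde N W F L gamma sigma alpha w0 j)) / L.
have aE : a (k.+1 - 1)%N = a_ k.-1.
  rewrite subn1 /a_ optde_weight.
  have -> : a k.+1.-1 = a k.-1.+1 by case: (k) => [|j].
  by rewrite a_closed_form// subn1 mulrAC.
have residual := optde_residual N_norm W_closed W_convex L_gt0 F_lipschitz
  gamma_gt0 gamma_le1 N_assumption w0_in sigma_gt0 wstar_sol alpha_gt0
  alpha_sqr k.
rewrite -/(a_ k.-1) -aE in residual.
set E := Num.sqrt (L / _) in residual *.
have kappa_ge0 : 0 <= 1 + delta / (alpha * gamma).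
  by rewrite addr_ge0// divr_ge0 ?mulr_ge0 ?ltW.
have N0 := is_norm_ge0 N_norm.
have gap y : W y ->
    dot (F wK) (wK - y) <= C0 * N (w0 - wstar) * E * N (wK - y).
  move=> Wy; apply: le_trans (optde_gap sigma N_norm W_closed W_convex L_gt0
    F_lipschitz gamma_gt0 delta_gt0 N_assumption w0_in alpha_gt0 k Wy) _.
  rewrite ler_wpM2r// /C0 -!mulrA ler_wpM2l// !mulrA.
  by move: residual; rewrite -/wK.
have B_ge0 : 0 <= C0 * N (w0 - wstar) * E.
  by rewrite !mulr_ge0 ?sqrtr_ge0.
split.
  apply: ge_ereal_sup => _ [y [Wy yD] <-]; rewrite lee_fin.
  apply: le_trans (gap y Wy) _.
  rewrite [leRHS](_ : _ = C0 * N (w0 - wstar) * E * D); last by ring.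
  by rewrite ler_wpM2l.
have [Wstar sol] := wstar_sol.
have [WwK _] : W wK /\ _ :=
  optde_in F L sigma alpha N_norm W_closed gamma_gt0 w0_in k.+1.
rewrite [leRHS](_ : _ = C0 * N (w0 - wstar) * E / sigma); last by ring.
have [->|n0] := eqVneq (N (wK - wstar)) 0; first by rewrite divr_ge0// ltW.
rewrite ler_pdivlMr// -(@ler_pM2r _ (N (wK - wstar))); last first.
  by rewrite lt_def n0 N0.
apply: le_trans (gap _ Wstar); apply: le_trans (sol _ WwK).
have B1 := bregman_ge N_assumption w0 wK wstar.
have B2 := bregman_ge N_assumption w0 wstar wK.
rewrite (is_normB N_norm wstar) in B1.
have := ler_wpM2l (ltW (divr_gt0 sigma_gt0 gamma_gt0)) (lerD B1 B2).
by congr (_ <= _); field; rewrite gt_eqF.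
Qed.
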